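(* Let $E$ be a Dedekind complete vector lattice with sup-inf-completion $E^{si}$. The bands in $E^{si}$ are precisely the subsets $\mathbb{P}(E^{si})$, where $\mathbb{P}$ is a band projection in $E$ extended to $E^{si}$.
   Context: Sup-completion. A cone is a commutative monoid with a scalar multiplication by $\mathbb{R}^+=[0,\infty)$ satisfying $\lambda(x+y)=\lambda x+\lambda y$, $(\lambda+\mu)x=\lambda x+\mu x$, $\lambda(\mu x)=(\lambda\mu)x$, $1x=x$, $0x=0$; a lattice cone is a cone with a lattice order compatible with addition and with multiplication by $\mathbb{R}^+$. The sup-completion $E^s$ is the essentially unique lattice cone $C$ such that: nonempty subsets of $C$ bounded above (below) have suprema (infima); $E$ is the set of additively invertible elements of $C$, with coinciding structures; $y=\sup\{x\in E: x\le y\}$ for $y\in C$; $z+(x\wedge y)=(z+x)\wedge(z+y)$ for $x\in E$, $y,z\in C$; $x\in E$, $y\in C$, $y\le x$ imply $y\in E$; $C$ has a largest element; and $\sup A=\sup B$ for nonempty $A,B\subseteq C$ implies $\sup(A\wedge x)=\sup(B\wedge x)$ for all $x\in E$. Sup-inf-completion. $E^{si}$ is (up to isomorphism) the set $\{(x,y)\in E^s_+\times E^s_+ : x\wedge y=0\}$, where $E^s_+=\{x\in E^s:x\ge0\}$, with scalar multiplication $\lambda(x,y)=(\lambda x,\lambda y)$, $-\lambda(x,y)=(\lambda y,\lambda x)$ for $\lambda\in\mathbb{R}^+$, ordered by $(x,y)\le(z,w)$ iff $x\le z$ and $w\le y$; it is a lattice. Each $x\in E^s$ (in particular each $x\in E$)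 is identified with $(x\vee 0,-(x\wedge 0))$. For $s\in E^{si}$: $s^+=s\vee0$, $s^-=-(s\wedge 0)$, $|s|=s\vee(-s)$. For $0\le u\in E^{si}$ let $[u]^{\leq}_+=\{x\in E^+ : x\le u\}$. Extension of band projections. A band projection $\mathbb{P}$ in $E$ is extended to $E^{si}$ by $\mathbb{P}(s):=\sup\{\inf\{\mathbb{P}(x-y): y\in[s^-]^{\leq}_+\}: x\in[s^+]^{\leq}_+\}$. Bands in $E^{si}$. A nonempty subset $T\subseteq E^{si}$ is a lattice substar if $\lambda x, x\vee y, x\wedge y\in T$ for all $x,y\in T$, $\lambda\in\mathbb{R}$. A lattice substar $T$ is an ideal if $x\in E^{si}$, $y\in T$, $|x|\le|y|$ imply $x\in T$. An ideal $T$ is a band if whenever a nonempty $A\subseteq T$ has a supremum in $E^{si}$, then $\sup A\in T$. *)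

(* Defs.v *)
From HB Require Import structures.
From mathcomp Require Import all_boot all_order all_algebra.
From mathcomp Require Import all_classical reals.

Set Implicit Arguments.
Unset Strict Implicit.
Unset Printing Implicit Defensive.

Import Order.TTheory GRing.Theory Num.Theory.

Local Open Scope classical_set_scope.
(* Shadows the set notations: [`&`] and [`|`] below are lattice operations. *)
Local Open Scope order_scope.
Local Open Scope ring_scope.

Record latticeOrder (T : Type) := LatticeOrder {
  lo_le : rel T ;
  lo_meet : T -> T -> T ;
  lo_join : T -> T -> T ;
  lo_refl : reflexive lo_le ;
  lo_anti : antisymmetric lo_le ;
  lo_trans : transitive lo_le ;
  lo_meetP : forall x y z, lo_le x (lo_meet y z) = lo_le x y && lo_le x z ;
  lo_joinP : forall x y z, lo_le (lo_join x y) z = lo_le x z && lo_le y z }.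

(* Vector lattices and lattice cones are plain records because
   Hierarchy-Builder rejects a structure joining [GRing.Lmodule] and
   [Order.Lattice]: its join with [Num.RealDomain] is missing upstream.
   Their carriers receive the library's (semi)module and lattice instances. *)
Record vectorLatticeType (R : realType) := VectorLattice {
  vl_lmod : lmodType R ;
  vl_order : latticeOrder vl_lmod ;
  vl_order_leD2r : forall x y z : vl_lmod,
    lo_le vl_order x y -> lo_le vl_order (x + z) (y + z) ;
  vl_order_leZ : forall (a : R) (x y : vl_lmod),
    0 <= a -> lo_le vl_order x y -> lo_le vl_order (a *: x) (a *: y) }.

Definition vl_sort (R : realType) (E : vectorLatticeType R) : Type :=
  vl_lmod E.
Coercion vl_sort : vectorLatticeType >-> Sortclass.

Section VectorLatticeInstances.
Variables (R : realType) (E : vectorLatticeType R).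

HB.instance Definition _ := GRing.Lmodule.copy (vl_sort E) (vl_lmod E).
HB.instance Definition _ := Order.Le_isPOrder.Build ring_display (vl_sort E)
  (lo_refl (vl_order E)) (@lo_anti _ (vl_order E)) (@lo_trans _ (vl_order E)).
HB.instance Definition _ := Order.POrder_MeetJoin_isLattice.Build ring_display
  (vl_sort E) (lo_meetP (vl_order E)) (lo_joinP (vl_order E)).

Lemma vl_leD2r (x y z : E) : x <= y -> x + z <= y + z.
Proof. exact: vl_order_leD2r. Qed.

Lemma vl_leZ (a : R) (x y : E) : 0 <= a -> x <= y -> a *: x <= a *: y.
Proof. exact: vl_order_leZ. Qed.

End VectorLatticeInstances.

(* The semiring [0, +oo[ of scalars of a cone: an [lSemiModType (nneg R)] is
   exactly a cone. *)
Section NonNegativeScalars.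
Variable R : realType.

Record nneg := NNeg { nnegval :> R; _ : nnegval \is Num.nneg }.

HB.instance Definition _ := [isSub for nnegval].
HB.instance Definition _ := [Choice of nneg by <:].
HB.instance Definition _ := [SubChoice_isSubComNzSemiRing of nneg by <:].

Definition nneg_abs (a : R) : nneg := NNeg (normr_nneg a).

End NonNegativeScalars.

Record latticeConeType (R : realType) := LatticeCone {
  lc_lmod : lSemiModType (nneg R) ;
  lc_order : latticeOrder lc_lmod ;
  lc_order_leD2r : forall x y z : lc_lmod,
    lo_le lc_order x y -> lo_le lc_order (x + z) (y + z) ;
  lc_order_leZ : forall (a : nneg R) (x y : lc_lmod),
    lo_le lc_order x y -> lo_le lc_order (a *: x) (a *: y) }.

Definition lc_sort (R : realType) (C : latticeConeType R) : Type :=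
  lc_lmod C.
Coercion lc_sort : latticeConeType >-> Sortclass.

Section LatticeConeInstances.
Variables (R : realType) (C : latticeConeType R).

HB.instance Definition _ := GRing.LSemiModule.copy (lc_sort C) (lc_lmod C).
HB.instance Definition _ := Order.Le_isPOrder.Build ring_display (lc_sort C)
  (lo_refl (lc_order C)) (@lo_anti _ (lc_order C)) (@lo_trans _ (lc_order C)).
HB.instance Definition _ := Order.POrder_MeetJoin_isLattice.Build ring_display
  (lc_sort C) (lo_meetP (lc_order C)) (lo_joinP (lc_order C)).

Lemma lc_leD2r (x y z : C) : x <= y -> x + z <= y + z.
Proof. exact: lc_order_leD2r. Qed.

Lemma lc_leZ (a : nneg R) (x y : C) : x <= y -> a *: x <= a *: y.
Proof. exact: lc_order_leZ. Qed.

End LatticeConeInstances.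

Definition dedekind_complete (d : Order.disp_t) (T : porderType d) : Prop :=
  (forall A : set T, A !=set0 -> has_ubound A -> supremums A !=set0) /\
  (forall A : set T, A !=set0 -> has_lbound A -> infimums A !=set0).

Section VectorLatticeBands.
Context {R : realType} {E : vectorLatticeType R}.

Definition vabs (x : E) : E := x `|` (- x).

Definition vdisjoint (x y : E) : Prop := vabs x `&` vabs y = 0.

Record vl_ideal (B : set E) : Prop := VlIdeal {
  vl_ideal0 : B 0 ;
  vl_idealD : forall x y, B x -> B y -> B (x + y) ;
  vl_idealZ : forall (a : R) x, B x -> B (a *: x) ;
  vl_ideal_solid : forall x y, B y -> vabs x <= vabs y -> B x }.

Definition vl_band (B : set E) : Prop :=
  vl_ideal B /\
  forall (A : set E) (s : E),
    A `<=` B -> A !=set0 -> supremums A s -> B s.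

Definition disjoint_compl (B : set E) : set E :=
  [set x | forall y, B y -> vdisjoint x y].

(* [P] is the projection onto [B] along [disjoint_compl B]; that every [x]
   decomposes says that [B] is a projection band. *)
Definition band_projection (P : E -> E) : Prop :=
  exists2 B : set E, vl_band B &
    forall x : E, B (P x) /\ disjoint_compl B (x - P x).

End VectorLatticeBands.

Record supCompletion (R : realType) (E : vectorLatticeType R) := SupCompletion {
  sc_sort :> latticeConeType R ;
  sc_emb : E -> sc_sort ;
  sc_dedekind : dedekind_complete sc_sort ;
  sc_embP : forall y : sc_sort,
    (exists z : sc_sort, y + z = 0) <-> (exists x : E, sc_emb x = y) ;
  sc_emb_le : forall x y : E, (sc_emb x <= sc_emb y) = (x <= y) ;
  sc_embI : forall x y : E, sc_emb (x `&` y) = sc_emb x `&` sc_emb y ;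
  sc_embU : forall x y : E, sc_emb (x `|` y) = sc_emb x `|` sc_emb y ;
  sc_embD : forall x y : E, sc_emb (x + y) = sc_emb x + sc_emb y ;
  sc_embZ : forall (a : nneg R) (x : E), sc_emb ((a : R) *: x) = a *: sc_emb x ;
  sc_sup_emb : forall y : sc_sort,
    supremums (sc_emb @` [set x | sc_emb x <= y]) y ;
  sc_addI : forall (x : E) (y z : sc_sort),
    z + (sc_emb x `&` y) = (z + sc_emb x) `&` (z + y) ;
  sc_emb_down : forall (x : E) (y : sc_sort),
    y <= sc_emb x -> exists x' : E, sc_emb x' = y ;
  sc_top : exists m : sc_sort, forall y : sc_sort, y <= m ;
  (* By [sc_dedekind] and [sc_top] all these suprema exist, so the default
     value [0] plays no role. *)
  sc_sup_meet : forall A B : set sc_sort, A !=set0 -> B !=set0 ->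
    supremum (0 : sc_sort) A = supremum (0 : sc_sort) B ->
    forall x : E, supremum (0 : sc_sort) [set a `&` sc_emb x | a in A] =
                  supremum (0 : sc_sort) [set b `&` sc_emb x | b in B] }.

Section SupInfCompletion.
Context {R : realType} {E : vectorLatticeType R}.
Variable S : supCompletion E.

Local Notation emb := (@sc_emb _ _ S).

Record supInf := SupInf {
  si_val : S * S ;
  _ : [&& (0 : S) <= si_val.1, (0 : S) <= si_val.2
        & si_val.1 `&` si_val.2 == 0] }.

HB.instance Definition _ := [isSub for si_val].
HB.instance Definition _ := [Choice of supInf by <:].

Definition si_pair (x y : S) (x0 : (0 : S) <= x) (y0 : (0 : S) <= y)
    (xy : x `&` y = 0) : supInf :=
  @SupInf (x, y) (introT and3P (And3 x0 y0 (introT eqP xy))).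

Lemma si_ge0l (s : supInf) : (0 : S) <= (val s).1.
Proof. by case/and3P: (valP s). Qed.

Lemma si_ge0r (s : supInf) : (0 : S) <= (val s).2.
Proof. by case/and3P: (valP s). Qed.

Lemma si_meet0 (s : supInf) : (val s).1 `&` (val s).2 = 0.
Proof. by case/and3P: (valP s) => _ _ /eqP. Qed.

Definition si_le (s t : supInf) : bool :=
  ((val s).1 <= (val t).1) && ((val t).2 <= (val s).2).

Fact si_le_refl : reflexive si_le.
Proof. by move=> s; rewrite /si_le !lexx. Qed.

Fact si_le_anti : antisymmetric si_le.
Proof.
move=> s t /andP[/andP[s1 t2] /andP[t1 s2]]; apply: val_inj.
have e1 : (val s).1 = (val t).1 by apply/le_anti; rewrite s1 t1.
have e2 : (val s).2 = (val t).2 by apply/le_anti; rewrite s2 t2.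
by case: (val s) (val t) e1 e2 => [? ?] [? ?] /= -> ->.
Qed.

Fact si_le_trans : transitive si_le.
Proof.
move=> t s u /andP[s1 t2] /andP[t1 u2].
by rewrite /si_le (le_trans s1 t1) (le_trans u2 t2).
Qed.

HB.instance Definition _ :=
  Order.Le_isPOrder.Build ring_display supInf si_le_refl si_le_anti si_le_trans.

Lemma emb0 : emb 0 = 0.
Proof.
by have := @sc_embZ _ _ S 0 0; rewrite /= scaler0 scale0r.
Qed.

Lemma supremum_eq (A : set S) (s : S) :
  A !=set0 -> supremums A s -> supremum (0 : S) A = s.
Proof.
move=> /set0P/negbTE A0 As; rewrite /supremum A0.
case: xgetP => [t _ At|/(_ s)//]; exact: (is_subset1_supremums At As).
Qed.

Lemma sc_le0 (u : S) :
  (forall e : E, 0 <= e -> emb e <= u -> e <= 0) -> (0 : S) <= u -> u = 0.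
Proof.
move=> H u0; apply/le_anti; rewrite u0 andbT.
have [_ /(_ 0)] := @sc_sup_emb _ _ S u; apply => _ [e /= eu <-].
rewrite -emb0 (@sc_emb_le _ _ S); apply: le_trans (leUl e 0) _.
by apply: H; [exact: leUr|rewrite (@sc_embU _ _ S) leUx eu emb0].
Qed.

Lemma sup_disjoint (A : set S) (s u : S) : A !=set0 -> supremums A s ->
  (0 : S) <= u -> (forall a, A a -> (0 : S) <= a /\ a `&` u = 0) -> s `&` u = 0.
Proof.
move=> A0 As u0 Au.
have [a0 Aa0] := A0; have [a0_ge0 _] := Au _ Aa0.
have s0 : (0 : S) <= s by apply: le_trans a0_ge0 _; case: As => + _; exact.
apply: sc_le0; last by rewrite lexI s0.
move=> e e0; rewrite lexI => /andP[es eu].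
have s1 : [set s] !=set0 by exists s.
have := @sc_sup_meet _ _ S A [set s] A0 s1.
rewrite (supremum_eq A0 As) supremum1 => /(_ erefl e).
rewrite image_set1 supremum1 (meet_r es) => eq_e.
rewrite -(@sc_emb_le _ _ S) -eq_e emb0.
suff -> : [set a `&` emb e | a in A] = [set 0] by rewrite supremum1.
apply/seteqP; split=> [_ [a Aa <-]|_ ->] /=; last first.
  exists a0 => //; apply/le_anti; rewrite lexI a0_ge0 -{2}emb0.
  rewrite (@sc_emb_le _ _ S) e0 andbT.
  by have [_ <-] := Au _ Aa0; rewrite leI2.
have [age0 <-] := Au _ Aa; apply/le_anti; rewrite leI2 //=.
by have [_ ->] := Au _ Aa; rewrite lexI age0 -emb0 (@sc_emb_le _ _ S).
Qed.

Lemma join_disjoint (x y u : S) : (0 : S) <= x -> (0 : S) <= y -> (0 : S) <= u ->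
  x `&` u = 0 -> y `&` u = 0 -> (x `|` y) `&` u = 0.
Proof.
move=> x0 y0 u0 xu yu; apply: (@sup_disjoint [set x; y]) => //.
- by exists x; left.
- split=> [z [->|->]|z zb]; rewrite ?leUl ?leUr // leUx.
  by rewrite !zb //; [right|left].
- by move=> a [->|->].
Qed.

Fact meet_ge0 (x y : S) : (0 : S) <= x -> (0 : S) <= y -> (0 : S) <= x `&` y.
Proof. by rewrite lexI => -> ->. Qed.

Fact join_ge0 (x y : S) : (0 : S) <= x -> (0 : S) <= x `|` y.
Proof. by move=> x0; apply: le_trans x0 (leUl _ _). Qed.

Fact si_join_subproof (s t : supInf) :
  ((val s).1 `|` (val t).1) `&` ((val s).2 `&` (val t).2) = 0.
Proof.
apply: join_disjoint; rewrite ?meet_ge0 ?si_ge0l ?si_ge0r //.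
- by rewrite meetA si_meet0 meet_l ?si_ge0r.
- by rewrite meetCA si_meet0 meet_r ?si_ge0r.
Qed.

Fact si_meet_subproof (s t : supInf) :
  ((val s).1 `&` (val t).1) `&` ((val s).2 `|` (val t).2) = 0.
Proof.
rewrite meetC; apply: join_disjoint; rewrite ?meet_ge0 ?si_ge0l ?si_ge0r //.
- by rewrite meetA [_.2 `&` _]meetC si_meet0 meet_l ?si_ge0l.
- by rewrite meetCA [_.2 `&` _]meetC si_meet0 meet_r ?si_ge0l.
Qed.

Definition si_join (s t : supInf) : supInf :=
  si_pair (join_ge0 _ (si_ge0l s)) (meet_ge0 (si_ge0r s) (si_ge0r t))
          (si_join_subproof s t).

Definition si_meet (s t : supInf) : supInf :=
  si_pair (meet_ge0 (si_ge0l s) (si_ge0l t)) (join_ge0 _ (si_ge0r s))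
          (si_meet_subproof s t).

Fact si_meetP (s t u : supInf) :
  (s <= si_meet t u) = (s <= t) && (s <= u).
Proof. by rewrite /Order.le /= /si_le /= lexI leUx andbACA. Qed.

Fact si_joinP (s t u : supInf) :
  (si_join s t <= u) = (s <= u) && (t <= u).
Proof. by rewrite /Order.le /= /si_le /= lexI leUx andbACA. Qed.

HB.instance Definition _ := Order.POrder_MeetJoin_isLattice.Build
  ring_display supInf si_meetP si_joinP.

Definition si0 : supInf :=
  si_pair (lexx (0 : S)) (lexx (0 : S)) (meetxx (0 : S)).

Definition si_opp (s : supInf) : supInf :=
  si_pair (si_ge0r s) (si_ge0l s) (etrans (meetC _ _) (si_meet0 s)).

Fact sc_scale_ge0 (a : nneg R) (x : S) : (0 : S) <= x -> (0 : S) <= a *: x.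
Proof. by move=> /(lc_leZ a); rewrite scaler0. Qed.

Fact si_nscale_subproof (a : nneg R) (s : supInf) :
  (a *: (val s).1) `&` (a *: (val s).2) = 0.
Proof.
apply/le_anti/andP; split; last first.
  by rewrite meet_ge0 // sc_scale_ge0 ?si_ge0l ?si_ge0r.
have [a0|a_neq0] := eqVneq a 0; first by rewrite a0 !scale0r meetxx.
have [b ba1] : exists b : nneg R, b * a = 1.
  exists (nneg_abs (a : R)^-1); apply: val_inj => /=.
  rewrite ger0_norm ?invr_ge0; last exact: (valP a).
  by rewrite mulVf //; apply: contra_neq a_neq0 => a0; apply: val_inj.
have ab1 : a * b = 1 by rewrite mulrC.
set m := _ `&` _.
have bx x : m <= a *: x -> b *: m <= x.
  by move=> /(lc_leZ b); rewrite scalerA ba1 scale1r.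
have : b *: m <= (0 : S).
  by rewrite -(si_meet0 s) lexI; apply/andP; split; apply: bx;
    [exact: leIl | exact: leIr].
by move=> /(lc_leZ a); rewrite scaler0 scalerA ab1 scale1r.
Qed.

Definition si_nscale (a : nneg R) (s : supInf) : supInf :=
  si_pair (sc_scale_ge0 a (si_ge0l s)) (sc_scale_ge0 a (si_ge0r s))
          (si_nscale_subproof a s).

Definition si_scale (a : R) (s : supInf) : supInf :=
  if 0 <= a then si_nscale (nneg_abs a) s
  else si_opp (si_nscale (nneg_abs a) s).

Lemma si_opp_le (s t : supInf) : (si_opp s <= si_opp t) = (t <= s).
Proof. by rewrite /Order.le /= /si_le /= andbC. Qed.

Lemma si_oppK : involutive si_opp.
Proof. by move=> s; apply: val_inj => /=; case: (val s). Qed.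

Lemma supInf_supremums (A : set supInf) : A !=set0 -> supremums A !=set0.
Proof.
move=> [s0 As0]; have [dsup dinf] := sc_dedekind S.
pose A1 := [set (val s).1 | s in A]; pose A2 := [set (val s).2 | s in A].
have A1_neq0 : A1 !=set0 by exists (val s0).1, s0.
have A2_neq0 : A2 !=set0 by exists (val s0).2, s0.
have [x xA1] : supremums A1 !=set0.
  by apply: dsup => //; have [m mP] := sc_top S; exists m => z _; exact: mP.
have [y yA2] : infimums A2 !=set0.
  by apply: dinf => //; exists 0 => _ [s As <-]; exact: si_ge0r.
have A1x s : A s -> (val s).1 <= x by move=> As; apply: xA1.1; exists s.
have yA s : A s -> y <= (val s).2 by move=> As; apply: yA2.1; exists s.
have x_ge0 : (0 : S) <= x := le_trans (si_ge0l s0) (A1x _ As0).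
have y_ge0 : (0 : S) <= y by apply: yA2.2 => _ [s _ <-]; exact: si_ge0r.
have xy : x `&` y = 0.
  apply: (sup_disjoint A1_neq0 xA1 y_ge0) => _ [s As <-].
  split; first exact: si_ge0l.
  apply/le_anti; rewrite meet_ge0 ?si_ge0l // andbT.
  by rewrite -[leRHS](si_meet0 s) leI2 // yA.
exists (si_pair x_ge0 y_ge0 xy); split=> [s As|t tA].
  by apply/andP; split; [exact: A1x | exact: yA].
apply/andP; split.
  by apply: xA1.2 => _ [s /tA/andP[st _] <-].
by apply: yA2.2 => _ [s /tA/andP[_ ts] <-].
Qed.

Lemma supInf_infimums (A : set supInf) : A !=set0 -> infimums A !=set0.
Proof.
move=> [s0 As0]; have [|t [tA t_min]] := @supInf_supremums (si_opp @` A).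
  by exists (si_opp s0), s0.
exists (si_opp t); split=> [s As|u uA].
  by rewrite -[s]si_oppK si_opp_le; apply: tA; exists s.
rewrite -[u]si_oppK si_opp_le; apply: t_min => _ [s As <-].
by rewrite si_opp_le; apply: uA.
Qed.

Definition si_pos (s : supInf) : supInf := s `|` si0.
Definition si_neg (s : supInf) : supInf := si_opp (s `&` si0).
Definition si_abs (s : supInf) : supInf := s `|` si_opp s.

Fact si_emb_ge0l (x : E) : (0 : S) <= emb (x `|` 0).
Proof. by rewrite -emb0 (@sc_emb_le _ _ S) leUr. Qed.

Fact si_emb_ge0r (x : E) : (0 : S) <= emb (- (x `&` 0)).
Proof.
rewrite -emb0 (@sc_emb_le _ _ S).
by have := vl_leD2r (- (x `&` 0)) (leIr (0 : E) x); rewrite subrr add0r.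
Qed.

Fact si_emb_subproof (x : E) : emb (x `|` 0) `&` emb (- (x `&` 0)) = 0 :> S.
Proof.
apply/le_anti/andP; split; last first.
  by rewrite meet_ge0 ?si_emb_ge0l ?si_emb_ge0r.
rewrite -(@sc_embI _ _ S) -emb0 (@sc_emb_le _ _ S).
set p := x `|` 0; set n := - (x `&` 0); set m := p `&` n.
have xp : x - p <= - n.
  rewrite /n opprK lexI; apply/andP; split.
    have := vl_leD2r (x - p) (leUr (0 : E) x : 0 <= p).
    by rewrite add0r addrCA subrr addr0.
  by have := vl_leD2r (- p) (leUl x (0 : E)); rewrite subrr.
have xpm : x <= p - m.
  have := vl_leD2r p xp; rewrite subrK addrC => /le_trans; apply.
  have := vl_leD2r (p - n - m) (leIr n p : m <= n).
  by rewrite [leLHS]addrC subrK [leRHS]addrA [n + _]addrCA subrr addr0.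
have pm0 : p <= p - m.
  rewrite {1}/p leUx xpm /=.
  by have := vl_leD2r (- m) (leIl p n : m <= p); rewrite subrr.
have := vl_leD2r (m - p) pm0.
by rewrite [leRHS]addrA subrK subrr addrCA subrr addr0.
Qed.

Definition si_emb (x : E) : supInf :=
  si_pair (si_emb_ge0l x) (si_emb_ge0r x) (si_emb_subproof x).

Definition below_pos (u : supInf) : set E :=
  [set x | 0 <= x /\ si_emb x <= u].

(* The default [si0] plays no role: [supInf] is a complete lattice, see
   [supInf_supremums] and [supInf_infimums]. *)
Definition extend (P : E -> E) (s : supInf) : supInf :=
  supremum si0
    [set infimum si0 [set si_emb (P (x - y)) | y in below_pos (si_neg s)]
       | x in below_pos (si_pos s)].

Record lattice_substar (T : set supInf) : Prop := LatticeSubstar {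
  substar_neq0 : T !=set0 ;
  substarZ : forall (a : R) s, T s -> T (si_scale a s) ;
  substarU : forall s t, T s -> T t -> T (s `|` t) ;
  substarI : forall s t, T s -> T t -> T (s `&` t) }.

Definition si_ideal (T : set supInf) : Prop :=
  lattice_substar T /\
  forall s t : supInf, T t -> si_abs s <= si_abs t -> T s.

Definition si_band (T : set supInf) : Prop :=
  si_ideal T /\
  forall (A : set supInf) (s : supInf),
    A `<=` T -> A !=set0 -> supremums A s -> T s.

End SupInfCompletion.

(* Main.v *)
(** For a band B of E with projection P, call an element t >= 0 of E^s
    dominated by B if every e in E with 0 <= e <= t lies in B.  The extended
    projection acts coordinatewise, (s1, s2) |-> (P s1, P s2) with
    P t = sup {P e : 0 <= e <= t}, so its range consists of the pairs whose two
    coordinates are dominated by B.  A supremum t of dominated elements is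
    dominated: for 0 <= e <= t, the part e - P e is disjoint from all of them,
    hence from t, hence is 0; so the range is a band.
    Conversely, a band T of E^si is determined by the elements of E^s lying
    below some |s| with s in T; it is recovered from its trace on E because
    every t >= 0 of E^s is the supremum of the elements of E^+ below it.  The
    trace is a band, and a projection band as E is Dedekind complete. *)

Require Import Defs.
From mathcomp Require Import all_boot all_order all_algebra.
From mathcomp Require Import all_classical reals.

Set Implicit Arguments.
Unset Strict Implicit.
Unset Printing Implicit Defensive.

Local Open Scope classical_set_scope.

Import Order.TTheory GRing.Theory Num.Theory.

Local Open Scope order_scope.
Local Open Scope ring_scope.

(** * Vector lattices: absolute values, disjoint complements and band projections *)

Section VectorLatticeTheory.
Context {R : realType} {E : vectorLatticeType R}.
Implicit Types (x y z : E) (B : set E) (P : E -> E).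

Lemma vl_leD2l z x y : x <= y -> z + x <= z + y.
Proof. by rewrite ![z + _]addrC; exact: vl_leD2r. Qed.

Lemma vl_leD x y z t : x <= y -> z <= t -> x + z <= y + t.
Proof. by move=> xy zt; apply: le_trans (vl_leD2r _ xy) (vl_leD2l _ zt). Qed.

Lemma vl_subr_ge0 x y : (0 <= y - x) = (x <= y).
Proof.
apply/idP/idP => [/(vl_leD2r x)|/(vl_leD2r (- x))].
  by rewrite add0r subrK.
by rewrite subrr.
Qed.

Lemma vl_leN2 x y : (- x <= - y) = (y <= x).
Proof. by rewrite -[LHS]vl_subr_ge0 opprK addrC vl_subr_ge0. Qed.

Lemma vl_subr_le x y : 0 <= y -> x - y <= x.
Proof. by move=> /(vl_leD2l (x - y)); rewrite addr0 subrK. Qed.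

Lemma vl_scale_ge0 (a : R) x : 0 <= a -> 0 <= x -> 0 <= a *: x.
Proof. by move=> a0 /(vl_leZ a0); rewrite scaler0. Qed.

Lemma vabsN x : vabs (- x) = vabs x.
Proof. by rewrite /vabs opprK joinC. Qed.

Lemma vabs_ge0 x : 0 <= vabs x.
Proof.
have : 0 <= vabs x + vabs x by rewrite -(subrr x) vl_leD ?leUl ?leUr.
have half_ge0 : 0 <= (2%:R^-1 : R) by rewrite invr_ge0 ler0n.
move=> /(vl_scale_ge0 half_ge0).
by rewrite -mulr2n -scaler_nat scalerA mulVf ?pnatr_eq0 // scale1r.
Qed.

Lemma vabs_le x y : (vabs x <= y) = (x <= y) && (- x <= y).
Proof. exact: leUx. Qed.

Lemma le_vabs x : x <= vabs x.
Proof. exact: leUl. Qed.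

Lemma leN_vabs x : - x <= vabs x.
Proof. exact: leUr. Qed.

Lemma ger0_vabs x : 0 <= x -> vabs x = x.
Proof.
move=> x0; apply: join_l; apply: (le_trans _ x0).
by rewrite -[0]oppr0 vl_leN2.
Qed.

Lemma vabs_eq0 x : vabs x = 0 -> x = 0.
Proof.
move=> x0; apply/le_anti; rewrite -{1}x0 le_vabs /=.
by rewrite -vl_leN2 oppr0 -x0 leN_vabs.
Qed.

Lemma vabsD x y : vabs (x + y) <= vabs x + vabs y.
Proof. by rewrite vabs_le opprD !vl_leD ?le_vabs ?leN_vabs. Qed.

Lemma vabsZ_le (a : R) x : vabs (a *: x) <= `|a| *: vabs x.
Proof.
have le_abs b y : 0 <= b -> vabs (b *: y) <= b *: vabs y.
  move=> b0; rewrite vabs_le -scalerN.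
  by rewrite !vl_leZ ?le_vabs ?leN_vabs.
have [a0|/ltW a0] := leP 0 a; first by rewrite ger0_norm ?le_abs.
by rewrite ler0_norm // -vabsN -scaleNr le_abs ?oppr_ge0.
Qed.

(** Here [z - x] lies below both [z] and [y], hence below their meet [0]; so [z <= x], and [z]
    equals its meet with [x]. *)
Lemma disjoint_le_add_eq0 x y z : 0 <= x -> z <= x + y ->
  0 <= z -> z `&` x = 0 -> z `&` y = 0 -> z = 0.
Proof.
move=> x0 zxy z0 zx zy.
have : z - x <= z `&` y.
  rewrite lexI; apply/andP; split.
    exact: vl_subr_le.
  by have := vl_leD2r (- x) zxy; rewrite addrAC subrr add0r.
by rewrite zy => /(vl_leD2r x); rewrite subrK add0r => /meet_idPl <-.
Qed.

(** For [y] in [B], solidity puts the meet of [vabs x] and [vabs y] into [B], so disjointness need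
    only be tested on positive elements of [B] below [vabs x]. *)
Lemma disjoint_complP B : vl_ideal B ->
  forall x, disjoint_compl B x <-> forall y, B y -> 0 <= y -> y <= vabs x -> y = 0.
Proof.
move=> IB x; split=> [dx y By y0 yx|H y By].
  by have := dx y By; rewrite /vdisjoint (ger0_vabs y0) (meet_r yx).
have m0 : 0 <= vabs x `&` vabs y by rewrite lexI !vabs_ge0.
apply: H => //; last exact: leIl.
by apply: vl_ideal_solid IB _ _ By _; rewrite (ger0_vabs m0) leIr.
Qed.

Lemma disjoint_complB B x y : vl_ideal B ->
  disjoint_compl B x -> disjoint_compl B y -> disjoint_compl B (x - y).
Proof.
move=> IB /(disjoint_complP IB) dx /(disjoint_complP IB) dy.
apply/(disjoint_complP IB) => z Bz z0 zxy.
have sub t : t <= z -> 0 <= t -> B t.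
  move=> tz t0; apply: vl_ideal_solid IB _ _ Bz _.
  by rewrite !ger0_vabs.
apply: (@disjoint_le_add_eq0 (vabs x) (vabs y)) => //.
- exact: vabs_ge0.
- by rewrite -(vabsN y); exact: le_trans zxy (vabsD _ _).
- have t0 : 0 <= z `&` vabs x by rewrite lexI z0 vabs_ge0.
  by apply: dx; rewrite ?leIr //; apply: sub; rewrite ?leIl.
- have t0 : 0 <= z `&` vabs y by rewrite lexI z0 vabs_ge0.
  by apply: dy; rewrite ?leIr //; apply: sub; rewrite ?leIl.
Qed.

Lemma vl_idealB B x y : vl_ideal B -> B x -> B y -> B (x - y).
Proof.
move=> IB Bx By; apply: vl_idealD => //.
by rewrite -scaleN1r; apply: vl_idealZ.
Qed.

Lemma disjoint_compl_eq0 B x : B x -> disjoint_compl B x -> x = 0.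
Proof. by move=> Bx /(_ _ Bx); rewrite /vdisjoint meetxx => /vabs_eq0. Qed.

(** Riesz decomposition. For [x >= 0] the component is the supremum [b] of the elements of [B] in
    [[0, x]]: if [y] in [B] satisfies [0 <= y <= x - b], then [b + y] is again such an element, so
    [b + y <= b]. A general [x] is the difference of the positive elements [vabs x] and
    [vabs x - x]. *)
Lemma band_decomposition B : dedekind_complete E -> vl_band B ->
  forall x, exists y, B y /\ disjoint_compl B (x - y).
Proof.
move=> [dsup _] [IB bandB].
have dec_ge0 x : 0 <= x -> exists y, B y /\ disjoint_compl B (x - y).
  move=> x0; pose A := [set y | [/\ B y, 0 <= y & y <= x]].
  have A0 : A !=set0 by exists 0; split; [exact: vl_ideal0 | | ].
  have [b Ab] : supremums A !=set0 by apply: dsup => //; exists x => y [].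
  have Bb : B b by apply: bandB Ab => // y [].
  have b0 : 0 <= b by apply: Ab.1; split; [exact: vl_ideal0 | | ].
  have bx : b <= x by apply: Ab.2 => y [].
  exists b; split=> //; apply/(disjoint_complP IB) => y By y0.
  rewrite ger0_vabs ?vl_subr_ge0 // => yxb.
  apply/le_anti; rewrite y0 andbT.
  have /(vl_leD2l (- b)) : b + y <= b.
    apply: Ab.1; split; first exact: vl_idealD.
    - by rewrite -[0]addr0 vl_leD.
    - by have := vl_leD2l b yxb; rewrite addrCA subrr addr0.
  by rewrite addKr addNr.
move=> x; have [p [Bp dp]] := dec_ge0 _ (vabs_ge0 x).
have [n [Bn dn]] : exists y, B y /\ disjoint_compl B (vabs x - x - y).
  by apply: dec_ge0; rewrite vl_subr_ge0 le_vabs.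
exists (p - n); split; first exact: vl_idealB.
suff -> : x - (p - n) = (vabs x - p) - (vabs x - x - n).
  exact: disjoint_complB.
by rewrite !opprB [RHS]addrC [RHS]addrA -[n + _ + _]addrA subrK addrCA addrA.
Qed.

Lemma band_projection_exists B : dedekind_complete E -> vl_band B ->
  exists P, forall x, B (P x) /\ disjoint_compl B (x - P x).
Proof.
by move=> Ec bB; have [P HP] := choice (band_decomposition Ec bB); exists P.
Qed.

(** The element [- b] lies below both [vabs b] and [vabs d]. Applied to the components [P x] and
    [x - P x] of [x >= 0], this yields [0 <= P x <= x]. *)
Lemma disjoint_add_ge0 (b d : E) : 0 <= b + d -> vdisjoint b d -> 0 <= b.
Proof.
move=> bd0 bd.
have bd' : - b <= d by rewrite -vl_subr_ge0 opprK addrC.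
by rewrite -vl_leN2 oppr0 -bd lexI leN_vabs (le_trans bd') // le_vabs.
Qed.

Section Projection.
Variables (B : set E) (P : E -> E).
Hypothesis IB : vl_ideal B.
Hypothesis HP : forall x, B (P x) /\ disjoint_compl B (x - P x).

(** The difference [P x - y] lies in [B] and in its disjoint complement. *)
Lemma projection_unique x y : B y -> disjoint_compl B (x - y) -> P x = y.
Proof.
move=> By dy; have [BP dP] := HP x; apply/subr0_eq.
apply: (@disjoint_compl_eq0 B); first exact: vl_idealB.
suff -> : P x - y = (x - y) - (x - P x) by exact: disjoint_complB.
by rewrite opprB [RHS]addrC [RHS]addrA subrK.
Qed.

Lemma projection_id x : B x -> P x = x.
Proof.
move=> Bx; apply: projection_unique => //; rewrite subrr.
apply/(disjoint_complP IB) => y _ y0; rewrite ger0_vabs // => y0'.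
by apply/le_anti; rewrite y0 y0'.
Qed.

Lemma projectionB x y : P (x - y) = P x - P y.
Proof.
have [Bx dx] := HP x; have [By dy] := HP y.
apply: projection_unique; first exact: vl_idealB.
suff -> : x - y - (P x - P y) = (x - P x) - (y - P y) by exact: disjoint_complB.
by rewrite !opprB [LHS]addrACA [RHS]addrACA [- P x + _]addrC.
Qed.

Lemma projection_ge0 x : 0 <= x -> 0 <= P x.
Proof.
move=> x0; have [BP dP] := HP x.
apply: (@disjoint_add_ge0 _ (x - P x)).
  by rewrite addrC subrK.
by rewrite /vdisjoint meetC; exact: dP.
Qed.

Lemma projection_le x : 0 <= x -> P x <= x.
Proof.
move=> x0; have [BP dP] := HP x; rewrite -vl_subr_ge0.
apply: (@disjoint_add_ge0 _ (P x)); first by rewrite subrK.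
exact: dP.
Qed.

End Projection.

(** A decomposition into disjoint positive elements is the one into positive and negative parts;
    this computes the coordinates of [si_emb] on a difference. *)
Lemma join0_sub_disjoint x y : 0 <= x -> 0 <= y -> x `&` y = 0 ->
  (x - y) `|` 0 = x /\ - ((x - y) `&` 0) = y.
Proof.
move=> x0 y0 xy; split; apply/le_anti/andP; split.
- by rewrite leUx x0 andbT vl_subr_le.
- set m := _ `|` _.
  have xm : x <= m + y by rewrite -[x](subrK y) vl_leD2r ?leUl.
  have : x - m <= x `&` y.
    rewrite lexI; apply/andP; split.
      by rewrite vl_subr_le ?leUr.
    by have := vl_leD2r (- m) xm; rewrite addrAC subrr add0r.
  by rewrite xy => /(vl_leD2r m); rewrite subrK add0r.
- rewrite -[leRHS]opprK vl_leN2 lexI -[X in _ && (_ <= X)]oppr0 vl_leN2 y0.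
  by rewrite andbT -{1}[- y]add0r vl_leD2r.
- set m := _ `&` _; rewrite -[leLHS]opprK vl_leN2.
  have my : m + y <= x by rewrite -[x](subrK y) vl_leD2r ?leIl.
  have : m + y <= x `&` y.
    by rewrite lexI my -{2}[y]add0r vl_leD2r ?leIr.
  by rewrite xy => /(vl_leD2r (- y)); rewrite addrK add0r.
Qed.

End VectorLatticeTheory.

Lemma supremum_unique d (T : porderType d) (x0 : T) (A : set T) s :
  A !=set0 -> supremums A s -> supremum x0 A = s.
Proof.
move=> /set0P/negbTE A0 As; rewrite /supremum A0.
case: xgetP => [t _ At|/(_ s)//]; exact: (is_subset1_supremums At As).
Qed.

Lemma infimum_unique d (T : porderType d) (x0 : T) (A : set T) s :
  A !=set0 -> infimums A s -> infimum x0 A = s.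
Proof.
move=> /set0P/negbTE A0 As; rewrite /infimum A0.
case: xgetP => [t _ At|/(_ s)//]; exact: (is_subset1_infimums At As).
Qed.

(** * Positive elements of the sup-completion and domination by an ideal *)

Section SupCompletionTheory.
Context {R : realType} {E : vectorLatticeType R}.
Variable S : supCompletion E.
Implicit Types (x y e f : E) (t u : S) (s : supInf S) (B : set E) (P : E -> E).

Local Notation emb := (@sc_emb _ _ S).

Lemma emb_le x y : (emb x <= emb y) = (x <= y).
Proof. exact: sc_emb_le. Qed.

Lemma emb_ge0 x : ((0 : S) <= emb x) = (0 <= x).
Proof. by rewrite -emb0 emb_le. Qed.

Lemma emb_eq0 x : emb x = 0 -> x = 0.
Proof.
by rewrite -emb0 => x0; apply/le_anti; rewrite -!emb_le x0 lexx.
Qed.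

Lemma sc_supremums (A : set S) : A !=set0 -> supremums A !=set0.
Proof.
move=> A0; have [dsup _] := sc_dedekind S; apply: dsup => //.
by have [m mP] := sc_top S; exists m => z _; exact: mP.
Qed.

Definition sc_below t : set E := [set e | 0 <= e /\ emb e <= t].

Lemma sc_below0 t : (0 : S) <= t -> sc_below t 0.
Proof. by move=> t0; split; rewrite // emb0. Qed.

Lemma sc_supremums_below t : (0 : S) <= t -> supremums (emb @` sc_below t) t.
Proof.
move=> t0; split=> [_ [e [_ et] <-]//|u tu].
apply: (sc_sup_emb t).2 => _ [e et <-].
apply: (@le_trans _ _ (emb (e `|` 0))); first by rewrite emb_le leUl.
apply: tu; exists (e `|` 0) => //; split; first exact: leUr.
by rewrite sc_embU leUx et emb0.
Qed.

(** The elements of E^s dominated by [B]; they turn out to be the fixed points of the extended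
    projection. *)
Definition pos_hull B : set S :=
  [set t | (0 : S) <= t /\ sc_below t `<=` B].

Lemma pos_hull_le B t u : pos_hull B u -> (0 : S) <= t -> t <= u -> pos_hull B t.
Proof.
move=> [_ uB] t0 tu; split=> // e [e0 et]; apply: uB; split=> //.
exact: le_trans tu.
Qed.

Lemma pos_hull_emb B x : vl_ideal B -> 0 <= x -> B x -> pos_hull B (emb x).
Proof.
move=> IB x0 Bx; split=> [|e [e0]]; first by rewrite emb_ge0.
by rewrite emb_le => ex; apply: vl_ideal_solid IB _ _ Bx _; rewrite !ger0_vabs.
Qed.

Lemma pos_hull0 B : vl_ideal B -> pos_hull B 0.
Proof.
by move=> IB; rewrite -emb0; apply: pos_hull_emb => //; exact: vl_ideal0.
Qed.

Lemma pos_hullZ B (a : nneg R) t : vl_ideal B -> pos_hull B t -> pos_hull B (a *: t).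
Proof.
move=> IB [t0 tB]; have [->|a0] := eqVneq a 0.
  by rewrite scale0r; exact: pos_hull0.
have aR0 : (a : R) != 0 by apply: contra_neq a0 => a0; apply: val_inj.
split=> [|e [e0 eat]]; first exact: sc_scale_ge0.
have aV_ge0 : 0 <= (a : R)^-1 by rewrite invr_ge0; exact: (valP a).
(* Write [e] as [a] times [a^-1 *: e]; the latter lies below [t], hence in [B]. *)
rewrite -[e]scale1r -(divff aR0) -scalerA.
apply: vl_idealZ => //; apply: tB; split; first exact: vl_scale_ge0.
have := lc_leZ (nneg_abs (a : R)^-1) eat.
rewrite -sc_embZ /= ger0_norm // scalerA.
suff -> : nneg_abs (a : R)^-1 * a = 1 by rewrite scale1r.
by apply: val_inj; rewrite /= ger0_norm // mulVf.
Qed.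

(** By [sc_le0] it suffices to look at positive [e] in [E] below both: such an [e] lies in [B] and
    below [f], so it vanishes. *)
Lemma pos_hull_disjoint B t f : vl_ideal B -> pos_hull B t ->
  disjoint_compl B f -> 0 <= f -> t `&` emb f = 0.
Proof.
move=> IB [t0 tB] df f0; apply: sc_le0; last by rewrite lexI t0 emb_ge0.
move=> e e0; rewrite lexI emb_le => /andP[et ef].
have := (disjoint_complP IB f).1 df e.
by rewrite ger0_vabs // => -> //; apply: tB.
Qed.

(** * The projection on positive elements of the sup-completion *)

Section BandProjection.
Variables (B : set E) (P : E -> E).
Hypothesis IB : vl_ideal B.
Hypothesis HP : forall x, B (P x) /\ disjoint_compl B (x - P x).

Lemma pos_hull_sup (A : set S) t :
  A `<=` pos_hull B -> A !=set0 -> supremums A t -> pos_hull B t.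
Proof.
move=> AB A0 At; have [a Aa] := A0.
split; first by apply: le_trans (AB _ Aa).1 _; exact: At.1.
move=> e [e0 et]; have [BPe de] := HP e.
suff -> : e = P e by [].
have f0 : 0 <= e - P e by rewrite vl_subr_ge0 (projection_le HP).
apply/subr0_eq/emb_eq0.
(* Since [0 <= e - P e <= e <= t], this meet is [emb (e - P e)] itself. *)
suff : t `&` emb (e - P e) = 0.
  rewrite meet_r // (le_trans _ et) // emb_le.
  by apply: vl_subr_le; exact: (projection_ge0 HP).
apply: (sup_disjoint A0 At); first by rewrite emb_ge0.
move=> b Ab; split; first exact: (AB _ Ab).1.
by apply: (pos_hull_disjoint IB) => //; exact: AB.
Qed.

Lemma pos_hullU t u : pos_hull B t -> pos_hull B u -> pos_hull B (t `|` u).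
Proof.
move=> Bt Bu; apply: (@pos_hull_sup [set t; u]).
- by move=> _ [->|->].
- by exists t; left.
- split=> [_ [->|->]|v tuv]; rewrite ?leUl ?leUr // leUx.
  by rewrite !tuv //; [right|left].
Qed.

Definition sc_proj t : S := supremum (0 : S) [set emb (P e) | e in sc_below t].

Lemma sc_proj_supremums t : (0 : S) <= t ->
  supremums [set emb (P e) | e in sc_below t] (sc_proj t).
Proof.
move=> t0; set A := [set _ | _ in _].
have A0 : A !=set0 by exists (emb (P 0)), 0 => //; exact: sc_below0.
by have [u Au] := sc_supremums A0; rewrite /sc_proj (supremum_unique _ A0 Au).
Qed.

Lemma pos_hull_sc_proj t : (0 : S) <= t -> pos_hull B (sc_proj t).
Proof.
move=> t0; apply: pos_hull_sup (sc_proj_supremums t0).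
  move=> _ [e [e0 _] <-]; apply: pos_hull_emb => //.
    exact: (projection_ge0 HP).
  exact: (HP e).1.
by exists (emb (P 0)), 0 => //; exact: sc_below0.
Qed.

Lemma sc_proj_le t : (0 : S) <= t -> sc_proj t <= t.
Proof.
move=> t0; apply: (sc_proj_supremums t0).2 => _ [e [e0 et] <-].
by apply: le_trans et; rewrite emb_le (projection_le HP).
Qed.

Lemma sc_proj_id t : pos_hull B t -> sc_proj t = t.
Proof.
move=> [t0 tB]; rewrite /sc_proj.
have -> : [set emb (P e) | e in sc_below t] = emb @` sc_below t.
  by apply: eq_imagel => e /tB Be; rewrite (projection_id IB HP).
apply: supremum_unique (sc_supremums_below t0).
by exists (emb 0), 0 => //; exact: sc_below0.
Qed.

End BandProjection.

(** * The extended projection in coordinates, and its range as a band *)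

Lemma si_leE s s' :
  (s <= s') = ((val s).1 <= (val s').1) && ((val s').2 <= (val s).2).
Proof. by []. Qed.

Lemma below_pos_pos s : below_pos (si_pos s) = sc_below (val s).1.
Proof.
apply/seteqP; split=> e [e0].
  by rewrite si_leE /= (join_l e0) (join_l (si_ge0l s)) => /andP[].
move=> es; split=> //; rewrite si_leE /= (join_l e0) (join_l (si_ge0l s)) es.
by rewrite (meet_r (si_ge0r s)) (meet_r e0) oppr0 emb0 lexx.
Qed.

Lemma below_pos_neg s : below_pos (si_neg s) = sc_below (val s).2.
Proof.
rewrite -[RHS](below_pos_pos (si_opp s)); congr below_pos.
by apply: val_inj.
Qed.

Section Extension.
Variables (B : set E) (P : E -> E).
Hypothesis IB : vl_ideal B.
Hypothesis HP : forall x, B (P x) /\ disjoint_compl B (x - P x).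

(** The elements [P x <= x] and [P y <= y] lie below the disjoint coordinates of [s], so they are
    the positive and negative parts of [P x - P y]. *)
Lemma val_si_emb_projectionB s x y : sc_below (val s).1 x ->
  sc_below (val s).2 y -> val (si_emb S (P (x - y))) = (emb (P x), emb (P y)).
Proof.
move=> [x0 xs] [y0 ys]; rewrite (projectionB IB HP).
have Px0 := projection_ge0 HP x0; have Py0 := projection_ge0 HP y0.
have [|/= -> ->//] := join0_sub_disjoint Px0 Py0.
apply: emb_eq0; apply/le_anti; rewrite emb_ge0 lexI Px0 Py0 andbT.
rewrite -(si_meet0 s) sc_embI leI2 //.
  by apply: le_trans xs; rewrite emb_le (projection_le HP).
by apply: le_trans ys; rewrite emb_le (projection_le HP).
Qed.

Lemma val_extend s :
  val (extend P s) = (sc_proj P (val s).1, sc_proj P (val s).2).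
Proof.
have [s1 s2] := (si_ge0l s, si_ge0r s).
set p := sc_proj P (val s).1; set q := sc_proj P (val s).2.
have [p0 _] : pos_hull B p := pos_hull_sc_proj IB HP s1.
have [q0 _] : pos_hull B q := pos_hull_sc_proj IB HP s2.
have disj u : (0 : S) <= u -> u <= (val s).1 -> u `&` q = 0.
  move=> u0 us; apply/le_anti; rewrite meet_ge0 // andbT.
  by rewrite -(si_meet0 s) leI2 // (sc_proj_le HP s2).
have pq : p `&` q = 0 by apply: disj => //; exact: (sc_proj_le HP s1).
suff -> : extend P s = si_pair p0 q0 pq by [].
(* For fixed [x] the infimum moves only the second coordinate. The order is reversed there, so the
   infimum over [y] is the supremum [q] of the [P y]. *)
have inner x : sc_below (val s).1 x ->
    val (infimum (si0 S) [set si_emb S (P (x - y)) | y in sc_below (val s).2])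
    = (emb (P x), q).
  move=> xs; have [x0 xs1] := xs.
  have Px0 : (0 : S) <= emb (P x) by rewrite emb_ge0 (projection_ge0 HP).
  have Pxq : emb (P x) `&` q = 0.
    by apply: disj => //; apply: le_trans xs1; rewrite emb_le (projection_le HP).
  rewrite (@infimum_unique _ _ _ _ (si_pair Px0 q0 Pxq)) //.
    by exists (si_emb S (P (x - 0))), 0 => //; exact: sc_below0.
  split=> [_ [y ys <-]|v vP].
    rewrite si_leE (val_si_emb_projectionB xs ys) lexx /=.
    by apply: (sc_proj_supremums P s2).1; exists y.
  have vle y : sc_below (val s).2 y ->
      ((val v).1 <= emb (P x)) && (emb (P y) <= (val v).2).
    move=> ys; have := vP (si_emb S (P (x - y))).
    by rewrite si_leE (val_si_emb_projectionB xs ys); apply; exists y.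
  rewrite si_leE; apply/andP; split.
    by have /andP[] := vle 0 (sc_below0 s2).
  by apply: (sc_proj_supremums P s2).2 => _ [y /vle/andP[_ ?] <-].
rewrite /extend below_pos_pos below_pos_neg; apply: supremum_unique.
  by eexists; exists 0; [exact: sc_below0|].
split=> [_ [x xs <-]|v vP].
  rewrite si_leE inner // lexx andbT /=.
  by apply: (sc_proj_supremums P s1).1; exists x.
have vle x : sc_below (val s).1 x ->
    (emb (P x) <= (val v).1) && ((val v).2 <= q).
  by move=> xs; have := vP _ (imageP _ xs); rewrite si_leE inner.
rewrite si_leE; apply/andP; split.
  by apply: (sc_proj_supremums P s1).2 => _ [x /vle/andP[? _] <-].
by have /andP[] := vle 0 (sc_below0 s1).
Qed.

Definition si_hull : set (supInf S) :=
  [set s | pos_hull B (val s).1 /\ pos_hull B (val s).2].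

Lemma range_extend : range (@extend R E S P) = si_hull.
Proof.
apply/seteqP; split=> [_ [s _ <-]|s [s1 s2]].
  rewrite /si_hull /= val_extend /=.
  by split; apply: pos_hull_sc_proj IB HP _ _; rewrite ?si_ge0l ?si_ge0r.
exists s => //; apply: val_inj; rewrite val_extend !(sc_proj_id IB HP) //.
by case: (val s).
Qed.

Lemma val_si_abs s : val (si_abs s) = ((val s).1 `|` (val s).2, 0).
Proof. by congr pair; rewrite meetC; exact: si_meet0. Qed.

Lemma si_band_hull : si_band si_hull.
Proof.
split; first split; first split.
- by exists (si0 S); split; exact: pos_hull0.
- move=> a s [s1 s2]; rewrite /si_scale.
  by case: ifP => _; split; apply: pos_hullZ.
- move=> s s' [s1 s2] [s1' s2']; split; first exact: (pos_hullU IB HP).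
  by apply: pos_hull_le s2 _ _; rewrite ?meet_ge0 ?si_ge0r ?leIl.
- move=> s s' [s1 s2] [s1' s2']; split; last exact: (pos_hullU IB HP).
  by apply: pos_hull_le s1 _ _; rewrite ?meet_ge0 ?si_ge0l ?leIl.
- move=> s s' [s1' s2']; rewrite si_leE !val_si_abs lexx andbT leUx.
  have h := pos_hullU IB HP s1' s2'.
  by move=> /andP[]; split; apply: pos_hull_le h _ _;
    rewrite ?si_ge0l ?si_ge0r.
move=> A s AT A0 As; have [a Aa] := A0.
split; last first.
  apply: pos_hull_le (AT _ Aa).2 (si_ge0r s) _.
  by have := As.1 _ Aa; rewrite si_leE => /andP[].
(* The supremum [t] of the first coordinates, paired with the second coordinate of [s], is an upper
   bound of [A]; hence the first coordinate of [s] is at most [t]. *)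
set A1 := [set (val b).1 | b in A].
have A1_neq0 : A1 !=set0 by exists (val a).1, a.
have [t At] := sc_supremums A1_neq0.
have t_ge0 : (0 : S) <= t.
  by apply: le_trans (si_ge0l a) _; apply: At.1; exists a.
have ts : t <= (val s).1.
  by apply: At.2 => _ [b Ab <-]; have := As.1 _ Ab; rewrite si_leE => /andP[].
have ts2 : t `&` (val s).2 = 0.
  apply/le_anti; rewrite meet_ge0 ?si_ge0r // andbT.
  by rewrite -[leRHS](si_meet0 s) leI2.
have Bt : pos_hull B t.
  by apply: (pos_hull_sup IB HP) A1_neq0 At => _ [b Ab <-]; exact: (AT _ Ab).1.
apply: pos_hull_le Bt (si_ge0l s) _.
suff : s <= si_pair t_ge0 (si_ge0r s) ts2 by rewrite si_leE => /andP[].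
apply: As.2 => b Ab; rewrite si_leE /=; apply/andP; split.
  by apply: At.1; exists b.
by have := As.1 _ Ab; rewrite si_leE => /andP[].
Qed.

End Extension.

(** * The trace of a band of the sup-inf-completion *)

Section BandTrace.
Variable T : set (supInf S).
Hypothesis bandT : si_band T.

(** The join is the first coordinate of [si_abs s], whose second coordinate is [0]. *)
Definition pos_trace : set S :=
  [set t | (0 : S) <= t /\ exists2 s, T s & t <= (val s).1 `|` (val s).2].

(** As [T] is solid, membership depends only on the absolute value. *)
Lemma pos_traceP s : T s <-> pos_trace ((val s).1 `|` (val s).2).
Proof.
split=> [Ts|[_ [s' Ts' ss']]].
  by split; [exact: join_ge0 (si_ge0l s)|exists s].
by apply: bandT.1.2 Ts' _; rewrite si_leE !val_si_abs lexx andbT.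
Qed.

Lemma pos_trace_le t u : pos_trace u -> (0 : S) <= t -> t <= u -> pos_trace t.
Proof.
move=> [_ [s Ts us]] t0 tu; split=> //.
by exists s => //; exact: le_trans us.
Qed.

Lemma pos_trace_abs t : pos_trace t -> exists2 s, T s & val s = (t, 0).
Proof.
move=> tT; exists (si_pair tT.1 (lexx (0 : S)) (meet_r tT.1)) => //.
by apply/pos_traceP; rewrite /= (join_l tT.1).
Qed.

Lemma pos_trace0 : pos_trace 0.
Proof.
have [s Ts] := substar_neq0 bandT.1.1; split=> //; exists s => //.
exact: join_ge0 (si_ge0l s).
Qed.

Lemma pos_traceZ (a : nneg R) t : pos_trace t -> pos_trace (a *: t).
Proof.
move=> tT; have [s Ts sE] := pos_trace_abs tT.
split; first exact: sc_scale_ge0 tT.1.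
exists (si_scale a s); first exact: substarZ bandT.1.1 _ _ Ts.
have a0 : 0 <= (a : R) := valP a.
rewrite /si_scale a0 /= sE /=.
have -> : nneg_abs a = a by apply: val_inj; rewrite /= ger0_norm.
exact: leUl.
Qed.

Lemma pos_traceU t u : pos_trace t -> pos_trace u -> pos_trace (t `|` u).
Proof.
move=> tT uT; have [s Ts sE] := pos_trace_abs tT.
have [s' Ts' sE'] := pos_trace_abs uT.
split; first exact: join_ge0 tT.1.
exists (s `|` s'); first exact: substarU bandT.1.1 _ _ Ts Ts'.
by rewrite /= sE sE' leUl.
Qed.

Lemma pos_trace_sup (A : set S) t :
  A `<=` pos_trace -> A !=set0 -> supremums A t -> pos_trace t.
Proof.
move=> AT [a Aa] At.
(* Taking every member of [T] with first coordinate in [A] avoids choosing a lift of each element;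
   the supremum of [A'] lies in [T] and its first coordinate dominates [t]. *)
pose A' := [set s | T s /\ A (val s).1].
have sub b : A b -> exists2 s, A' s & (val s).1 = b.
  move=> Ab; have [s Ts sE] := pos_trace_abs (AT _ Ab).
  by exists s; [split; rewrite ?sE|rewrite sE].
have A'0 : A' !=set0 by have [s ? _] := sub a Aa; exists s.
have [v A'v] := supInf_supremums A'0.
split; first by apply: le_trans (AT _ Aa).1 _; exact: At.1.
exists v; first by apply: bandT.2 A'0 A'v => s [].
apply: At.2 => b /sub[s A's <-].
have := A'v.1 _ A's; rewrite si_leE => /andP[sv _].
exact: le_trans sv (leUl _ _).
Qed.

Definition band_trace : set E := [set x | pos_trace (emb (vabs x))].

Lemma band_trace_le x y : pos_trace (emb y) -> vabs x <= y -> band_trace x.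
Proof.
move=> yT xy; apply: pos_trace_le yT _ _; first by rewrite emb_ge0 vabs_ge0.
by rewrite emb_le.
Qed.

(** A band of E^si is given with joins and scalar multiples but no sums; the trace is closed under
    addition because [vabs (x + y)] is at most twice the join of [vabs x] and [vabs y]. *)
Lemma pos_trace_emb2 x : pos_trace (emb x) -> pos_trace (emb (x + x)).
Proof.
move=> /(pos_traceZ (nneg_abs 2)); rewrite -sc_embZ /= ger0_norm ?ler0n //.
by rewrite scaler_nat mulr2n.
Qed.

Lemma vl_band_trace : vl_band band_trace.
Proof.
split; first split.
- by rewrite /band_trace /= ger0_vabs // emb0; exact: pos_trace0.
- move=> x y Bx By.
  have : pos_trace (emb (vabs x `|` vabs y)) by rewrite sc_embU; exact: pos_traceU.
  move=> /pos_trace_emb2/band_trace_le; apply; apply: le_trans (vabsD _ _) _.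
  by rewrite vl_leD ?leUl ?leUr.
- move=> a x /(pos_traceZ (nneg_abs a)); rewrite -sc_embZ => /band_trace_le; apply.
  exact: vabsZ_le.
- by move=> x y /band_trace_le; apply.
move=> A s AB [a Aa] As.
set A' := [set emb (vabs b `&` (s `|` 0)) | b in A].
have A'0 : A' !=set0 by exists (emb (vabs a `&` (s `|` 0))), a.
(* Truncating by the positive part of [s] keeps the supremum [u] inside [E]. *)
have [u A'u] := sc_supremums A'0.
have [v vE] : exists v, emb v = u.
  by apply: (@sc_emb_down _ _ S (s `|` 0)); apply: A'u.2 => _ [b _ <-];
     rewrite emb_le leIr.
have vb b : A b -> vabs b `&` (s `|` 0) <= v.
  by move=> Ab; rewrite -emb_le vE; apply: A'u.1; exists b.
(* Each [b] in [A] lies below [vabs b] and below the positive part of [s], hence below their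
   meet. *)
have sv : s <= v.
  apply: As.2 => b Ab; apply: le_trans (vb b Ab).
  by rewrite lexI le_vabs (le_trans (As.1 _ Ab)) ?leUl.
have uT : pos_trace (emb v).
  rewrite vE; apply: pos_trace_sup A'0 A'u => _ [b Ab <-].
  apply: pos_trace_le (AB _ Ab) _ _; first by rewrite emb_ge0 lexI vabs_ge0 leUr.
  by rewrite emb_le leIl.
(* The element [v] bounds [s] only from above; for [- s], one member [a] of [A] suffices, as
   [- s <= - a <= vabs a]. *)
apply: (@band_trace_le _ (v `|` vabs a)).
  by rewrite sc_embU; apply: pos_traceU => //; exact: AB.
rewrite vabs_le; apply/andP; split; first exact: le_trans sv (leUl _ _).
apply: le_trans (leUr _ _); apply: le_trans (leN_vabs a).
by rewrite vl_leN2; exact: As.1.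
Qed.

Lemma si_hull_band_trace : T = si_hull band_trace.
Proof.
apply/seteqP; split=> s.
  move=> /pos_traceP sT; split; split=> [|e [e0 es]];
    rewrite ?si_ge0l ?si_ge0r //; apply: band_trace_le (lexx _);
    apply: pos_trace_le sT _ _; rewrite ?emb_ge0 ?vabs_ge0 // ger0_vabs //;
    apply: le_trans es _; rewrite ?leUl ?leUr //.
have hullT t : pos_hull band_trace t -> pos_trace t.
  move=> [t0 tB]; apply: pos_trace_sup (sc_supremums_below t0).
    by move=> _ [e et <-]; rewrite -(ger0_vabs et.1); exact: tB.
  by exists (emb 0), 0 => //; exact: sc_below0.
by move=> [/hullT s1 /hullT s2]; apply/pos_traceP; exact: pos_traceU.
Qed.

End BandTrace.

End SupCompletionTheory.

Theorem proposition5p7 (R : realType) (E : vectorLatticeType R)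
    (E_complete : dedekind_complete E) (S : supCompletion E)
    (T : set (supInf S)) :
  si_band T <->
  exists2 P : E -> E, band_projection P & T = range (@extend R E S P).
Proof.
split=> [bandT|[P [B [IB _] HP] ->]]; last first.
  by rewrite (range_extend S IB HP); exact: (si_band_hull S IB HP).
have bB := vl_band_trace bandT.
have [P HP] := band_projection_exists E_complete bB.
exists P; first by exists (band_trace T).
by rewrite (range_extend S bB.1 HP); exact: si_hull_band_trace.
Qed.
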